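(* Let $\alpha\ge 0$, $N\ge 1$, and let $a_1,\dots,a_N\in\mathbb{R}\setminus\{0\}$ satisfy the non neutral sub-clusters hypothesis $$\forall P\subseteq\{1,\dots,N\}\text{ with }P\neq\emptyset\text{ and }P\neq\{1,\dots,N\},\qquad \sum_{i\in P}a_i\neq 0.$$ Then there exists a constant $C$, depending only on $N$, $\alpha$ and the intensities $a_i$, such that the following holds. Let $0<T<+\infty$ and let $X\in\mathbb{R}^{2N}$ be an initial datum such that the associated solution $t\mapsto (x_1(t),\dots,x_N(t))$ of the $\alpha$-point-vortex system with intensities $a_i$ is well defined on $[0,T)$. Then for all indices $i\neq j\in\{1,\dots,N\}$ such that $\liminf_{t\to T^-}|x_i(t)-x_j(t)|=0$, $$\forall\, t\in[0,T),\qquad |T-t|\le 1\ \Longrightarrow\ |x_i(t)-x_j(t)|\le C\,|T-t|^{\frac{1}{\alpha+1}}.$$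
   Context: For $x=(x_1,x_2)\in\mathbb{R}^2$, $x^\perp:=(-x_2,x_1)$. The $\alpha$-point-vortex system in the plane with intensities $a_1,\dots,a_N$ is the system of ODEs for $x_1(t),\dots,x_N(t)\in\mathbb{R}^2$: $$\frac{\mathrm d}{\mathrm dt}x_i(t)=\sum_{j\neq i}a_j\,\frac{(x_i(t)-x_j(t))^\perp}{|x_i(t)-x_j(t)|^{\alpha+1}},\qquad i=1,\dots,N.$$ The dynamics is well defined on $[0,T)$ if the solution exists on $[0,T)$ with no collapse there, i.e. $x_i(t)\ne x_j(t)$ for all $i\neq j$ and $t\in[0,T)$. *)

(* Defs.v *)
From HB Require Import structures.
From mathcomp Require Import all_boot all_order all_algebra.
From mathcomp Require Import all_classical all_reals all_analysis.

Set Implicit Arguments.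
Unset Strict Implicit.
Unset Printing Implicit Defensive.

Import Order.TTheory GRing.Theory Num.Theory.
Import numFieldNormedType.Exports.

Local Open Scope classical_set_scope.
Local Open Scope ring_scope.

(* The norm [`|x|] of the product type [R * R] is the sup norm, so the
   Euclidean norm of the plane is introduced separately. *)
Definition enorm {R : realType} (x : R * R) : R :=
  Num.sqrt (x.1 ^+ 2 + x.2 ^+ 2).

Definition perp {R : realType} (x : R * R) : R * R := (- x.2, x.1).

Definition vortex_velocity {R : realType} {N : nat} (alpha : R)
    (a : 'I_N -> R) (x : 'I_N -> R * R) (i : 'I_N) : R * R :=
  \sum_(j < N | j != i)
    (a j / enorm (x i - x j) `^ (alpha + 1)) *: perp (x i - x j).

(* A trajectory is a total function of time of which only the restriction to
   [0, T[ matters.  The equation is imposed on ]0, T[ together with continuity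
   on [0, T[; in the absence of collapse the right-hand side is continuous on
   [0, T[, so the one-sided equation at time 0 follows. *)
Definition well_defined_solution {R : realType} {N : nat} (alpha : R)
    (a : 'I_N -> R) (T : R) (X : 'I_N -> R * R) (x : 'I_N -> R -> R * R) : Prop :=
  [/\ forall i, x i 0 = X i,
      forall i, {within `[0, T[, continuous (x i)},
      forall i t, 0 < t < T ->
        is_derive t 1 (x i) (vortex_velocity alpha a (fun j => x j t) i)
    & forall i j t, i != j -> 0 <= t < T -> x i t <> x j t].

Definition non_neutral_subclusters {R : realType} {N : nat} (a : 'I_N -> R) : Prop :=
  forall P : {set 'I_N}, P != finset.set0 -> P != [set: 'I_N]%SET ->
    \sum_(i in P) a i != 0.

(* Main.v *)
Require Import Defs.
From HB Require Import structures.
From mathcomp Require Import all_boot all_order all_algebra.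
From mathcomp Require Import all_classical all_reals all_analysis.
From mathcomp Require Import ring lra.

Set Implicit Arguments.
Unset Strict Implicit.
Unset Printing Implicit Defensive.

Import Order.TTheory GRing.Theory Num.Theory.
Import numFieldNormedType.Exports.

Local Open Scope classical_set_scope.
Local Open Scope ring_scope.

(** The theorem is a quantitative form of the following principle: over a time
    interval of length [tau], the natural length scale of the dynamics is
    [L = tau `^ (alpha + 1)^-1], because a vortex at distance [L] induces a
    velocity of order [L `^ (- alpha)], hence a displacement of order
    [L `^ (- alpha) * tau = L].

    Call a cluster a set [P] of vortices that stays at distance at least [L] from
    all the other vortices.  The interactions inside [P] are antisymmetric, so
    they cancel in the velocity of [\sum_(p in P) a p *: x p], which therefore
    moves by at most a constant times [L] ([enorm_center_move_le]).  The main
    point is that not only this moment but each vortex of a cluster moves by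
    at most [C * L], although intensities of both signs forbid any control of the
    diameter of [P] by conserved quantities.  This is shown by induction on the
    cluster ([confinement_step], [confinement]), with the following
    dichotomy, where [C] is the constant obtained for smaller clusters and
    [D = N%:R * (2 * C + 2)].
    - Either the diameter of [P] is at most [D * L] at all times; dividing by the
      total intensity of [P], nonzero by hypothesis since [P] is a proper subset,
      shows that every vortex follows the center of vorticity of [P] up to
      a multiple of [L] ([confined_of_diam_le]).
    - Or the diameter of [P] exceeds [D * L] at some time [t].  The points of [P]
      cannot all be linked by jumps shorter than [(2 * C + 2) * L], so [P] splits
      at time [t] into two parts further than this from each other
      ([exists_gap_split]).  As long as the two parts remain [L]-separated they are themselves clusters, so their elements move by at
      most [C * L] and the parts are in fact [2 * L]-separated; by continuity
      the separation lasts over the whole interval ([separated_persists]), and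
      the induction hypothesis applies to each part.

    Finally, if [x i] and [x j] were further apart than a large multiple of
    [L] at time [t], with [L] the scale of the remaining time [T - t], the set of
    all the vortices would split in the same way into two parts separating [i]
    from [j], and these would remain [L]-separated until time [T],
    contradicting the collapse.  Both parts are proper subsets, so confinement
    applies to them. *)

(** * The Euclidean norm of the plane *)

Lemma enorm_ge0 (R : realType) (z : R * R) : 0 <= enorm z.
Proof. exact: sqrtr_ge0. Qed.

Lemma sqr_enorm (R : realType) (z : R * R) :
  enorm z ^+ 2 = z.1 ^+ 2 + z.2 ^+ 2.
Proof. by rewrite sqr_sqrtr // addr_ge0 ?sqr_ge0. Qed.

Lemma dot_le_enorm (R : realType) (z w : R * R) :
  z.1 * w.1 + z.2 * w.2 <= enorm z * enorm w.
Proof.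
apply: le_trans (ler_norm _) _.
rewrite -ler_sqr ?nnegrE ?mulr_ge0 ?enorm_ge0 ?normr_ge0 //.
rewrite real_normK ?num_real // exprMn !sqr_enorm.
rewrite -subr_ge0 (_ : _ - _ = (z.1 * w.2 - z.2 * w.1) ^+ 2) ?sqr_ge0 //.
by ring.
Qed.

Lemma ler_enormD (R : realType) (z w : R * R) :
  enorm (z + w) <= enorm z + enorm w.
Proof.
rewrite -ler_sqr ?nnegrE ?addr_ge0 ?enorm_ge0 //.
rewrite [leRHS]sqrrD !sqr_enorm /=.
have := dot_le_enorm z w.
by lra.
Qed.

Lemma enormZ (R : realType) (k : R) (z : R * R) :
  enorm (k *: z) = `|k| * enorm z.
Proof.
rewrite /enorm /= /GRing.scale /= -sqrtr_sqr -sqrtrM ?sqr_ge0 //.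
by congr Num.sqrt; ring.
Qed.

Lemma enormN (R : realType) (z : R * R) : enorm (- z) = enorm z.
Proof. by rewrite -scaleN1r enormZ normrN normr1 mul1r. Qed.

Lemma enorm0 (R : realType) : enorm (0 : R * R) = 0.
Proof. by rewrite -(scale0r (0 : R * R)) enormZ normr0 mul0r. Qed.

Lemma enorm_distC (R : realType) (z w : R * R) :
  enorm (z - w) = enorm (w - z).
Proof. by rewrite -enormN opprB. Qed.

Lemma ler_enorm_distD (R : realType) (y z w : R * R) :
  enorm (z - w) <= enorm (z - y) + enorm (y - w).
Proof. by rewrite (le_trans _ (ler_enormD _ _)) // addrA subrK. Qed.

Lemma enorm_perp (R : realType) (z : R * R) : enorm (perp z) = enorm z.
Proof. by rewrite /enorm /= sqrrN addrC. Qed.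

Lemma ler_enorm_sum (R : realType) (I : Type) (r : seq I) (P : pred I)
    (f : I -> R * R) (b : I -> R) : (forall i, P i -> enorm (f i) <= b i) ->
  enorm (\sum_(i <- r | P i) f i) <= \sum_(i <- r | P i) b i.
Proof.
move=> fb; elim/big_rec2 : _ => [|i c z Pi zc]; first by rewrite enorm0.
by apply: le_trans (ler_enormD _ _) _; rewrite lerD // fb.
Qed.

Lemma cvg_fst_comp (R : realType) (T : Type) (F : set_system T) (f : T -> R * R)
    (l : R * R) : Filter F -> f x @[x --> F] --> l ->
  (f x).1 @[x --> F] --> l.1.
Proof. by move=> FF fl; apply: cvg_comp fl _; exact: cvg_fst. Qed.

Lemma cvg_snd_comp (R : realType) (T : Type) (F : set_system T) (f : T -> R * R)
    (l : R * R) : Filter F -> f x @[x --> F] --> l ->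
  (f x).2 @[x --> F] --> l.2.
Proof. by move=> FF fl; apply: cvg_comp fl _; exact: cvg_snd. Qed.

Lemma cvg_enorm (R : realType) (T : Type) (F : set_system T) (f : T -> R * R)
    (l : R * R) : Filter F -> f x @[x --> F] --> l ->
  enorm (f x) @[x --> F] --> enorm l.
Proof.
move=> FF fl.
apply: (@cvg_comp _ _ _ (fun x => (f x).1 ^+ 2 + (f x).2 ^+ 2) Num.sqrt F
          (nbhs (l.1 ^+ 2 + l.2 ^+ 2))); last exact: sqrt_continuous.
by apply: cvgD; apply: cvgM; (exact: cvg_fst_comp || exact: cvg_snd_comp).
Qed.

(** Vector-valued trajectories are differentiated through their scalar products
    with a fixed vector, to which one-dimensional calculus applies. *)
Lemma is_derive_dot (R : realType) (F : R -> R * R) (r : R) (v w : R * R) :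
  is_derive r 1 F v ->
  is_derive r 1 (fun t => (F t).1 * w.1 + (F t).2 * w.2)
    (v.1 * w.1 + v.2 * w.2).
Proof.
move=> [dF Fv].
set phi := fun z : R * R => z.1 * w.1 + z.2 * w.2.
have FvC : h^-1 *: (F (h *: (1 : R) + r) - F r) @[h --> 0^'] --> v.
  by rewrite -Fv; exact: dF.
have phiC : h^-1 *: (phi (F (h *: (1 : R) + r)) - phi (F r)) @[h --> 0^']
    --> phi v.
  rewrite (_ : (fun h : R => _) =
    fun h => phi (h^-1 *: (F (h *: (1 : R) + r) - F r))).
    by apply: cvgD; apply: cvgM; (exact: cvg_fst_comp || exact: cvg_snd_comp ||
       exact: cvg_cst).
  by apply/funext => h; rewrite /phi /= /GRing.scale /=; ring.
apply: DeriveDef; first by apply/cvg_ex; exists (phi v).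
exact: cvg_lim phiC.
Qed.

(** The classical mean value theorem is applied to the scalar product of [F]
    with the fixed vector [F u - F s]; Cauchy-Schwarz then gives the sharp
    constant. *)
Lemma mean_value_enorm (R : realType) (F dF : R -> R * R) (s u K : R) :
  s <= u -> (forall r, s <= r <= u -> is_derive r 1 F (dF r)) ->
  (forall r, s <= r <= u -> enorm (dF r) <= K) ->
  enorm (F u - F s) <= K * (u - s).
Proof.
move=> su dFP dFK.
set w := F u - F s.
pose g t := (F t).1 * w.1 + (F t).2 * w.2.
have gP r : s <= r <= u -> is_derive r 1 g ((dF r).1 * w.1 + (dF r).2 * w.2).
  by move=> /dFP; exact: is_derive_dot.
have [r|r|c csu gE] := @MVT_segment R g
    (fun r => (dF r).1 * w.1 + (dF r).2 * w.2) s u su.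
- by rewrite in_itv /= => /andP[sr ru]; apply: gP; rewrite !ltW.
- apply: derivable_within_continuous => t; rewrite in_itv /= => /gP tP.
  exact: ex_derive.
have wE : enorm w ^+ 2 = g u - g s.
  by rewrite sqr_enorm /g /w /=; ring.
have wK : enorm w ^+ 2 <= (K * (u - s)) * enorm w.
  rewrite wE gE mulrAC ler_wpM2r ?subr_ge0 //.
  apply: le_trans (dot_le_enorm _ _) _.
  by rewrite ler_wpM2r ?enorm_ge0 // dFK // -in_itv.
have [w0|w_gt0] := leP (enorm w) 0.
  apply: le_trans w0 _; rewrite mulr_ge0 ?subr_ge0 //.
  by apply: le_trans (enorm_ge0 (dF s)) _; rewrite dFK // lexx.
by rewrite -(ler_pM2r w_gt0) -expr2.
Qed.

(** * The velocity of a center of vorticity *)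

Definition vortex_kernel {R : realType} (alpha : R) (z : R * R) : R * R :=
  (enorm z `^ (alpha + 1))^-1 *: perp z.

Lemma vortex_kernelN (R : realType) (alpha : R) (z : R * R) :
  vortex_kernel alpha (- z) = - vortex_kernel alpha z.
Proof. by rewrite /vortex_kernel enormN -scalerN; congr (_ *: _); rewrite /perp. Qed.

Lemma vortex_kernel0 (R : realType) (alpha : R) : vortex_kernel alpha (0 : R * R) = 0.
Proof. by rewrite /vortex_kernel /perp /= oppr0 (scaler0 (R * R)%type). Qed.

Lemma enorm_vortex_kernel_le (R : realType) (alpha L : R) (z : R * R) :
  0 <= alpha -> 0 < L -> L <= enorm z -> enorm (vortex_kernel alpha z) <= L `^ (- alpha).
Proof.
move=> a0 L0 Lz; have z0 : 0 < enorm z by exact: lt_le_trans Lz.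
have zN0 : enorm z != 0 by rewrite gt_eqF.
rewrite /vortex_kernel enormZ enorm_perp ger0_norm ?invr_ge0 ?powR_ge0 //.
rewrite powRD ?zN0 ?implybT // powRr1 ?enorm_ge0 // invfM mulfVK //.
rewrite powRN lef_pV2 ?posrE ?powR_gt0 //.
by rewrite ge0_ler_powR // nnegrE ltW.
Qed.

(** The kernel vanishes at the origin, so the self-interaction can be included. *)
Lemma vortex_velocityE (R : realType) (N : nat) (alpha : R) (a : 'I_N -> R)
    (y : 'I_N -> R * R) (i : 'I_N) :
  vortex_velocity alpha a y i = \sum_j a j *: vortex_kernel alpha (y i - y j).
Proof.
rewrite [RHS](bigD1 i) //= subrr vortex_kernel0 scaler0 add0r.
by apply: eq_bigr => j _; rewrite /vortex_kernel scalerA.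
Qed.

Lemma sum_antisym (R : realType) (I : finType) (P : pred I)
    (G : I -> I -> R * R) : (forall i j, G i j = - G j i) ->
  \sum_(i | P i) \sum_(j | P j) G i j = 0.
Proof.
move=> GN; set S := LHS.
have SN : S = - S.
  rewrite {1}/S exchange_big /= -sumrN; apply: eq_bigr => i _.
  by rewrite -sumrN; apply: eq_bigr => j _.
have : 2%:R *: S = 0 by rewrite scaler_nat mulr2n {2}SN subrr.
by move/eqP; rewrite scaler_eq0 pnatr_eq0 /= => /eqP.
Qed.

Lemma ler_sum_cond (R : realType) (I : finType) (P : pred I) (F : I -> R) :
  (forall i, 0 <= F i) -> \sum_(i | P i) F i <= \sum_i F i.
Proof. by move=> F0; rewrite [leRHS](bigID P) /= lerDl sumr_ge0. Qed.

(** Only the interactions between [P] and its complement contribute: the term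
    [a i * a j * K (y i - y j)] is antisymmetric in [i] and [j], so its sum over
    [P] x [P] vanishes.  The remaining terms are at most
    [`|a i| * `|a j| * L `^ (- alpha)]. *)
Lemma enorm_center_velocity_le (R : realType) (N : nat) (alpha : R)
    (a : 'I_N -> R) (y : 'I_N -> R * R) (P : {set 'I_N}) (L : R) :
  0 <= alpha -> 0 < L ->
  (forall p q, p \in P -> q \notin P -> L <= enorm (y p - y q)) ->
  enorm (\sum_(p in P) a p *: vortex_velocity alpha a y p)
    <= (\sum_i `|a i|) ^+ 2 * L `^ (- alpha).
Proof.
move=> alpha0 L0 Psep.
pose G i j := (a i * a j) *: vortex_kernel alpha (y i - y j).
have -> : \sum_(p in P) a p *: vortex_velocity alpha a y p =
    \sum_(p in P) \sum_(q | q \notin P) G p q.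
  transitivity (\sum_(p in P) (\sum_(q in P) G p q + \sum_(q | q \notin P) G p q)).
    apply: eq_bigr => p _; rewrite vortex_velocityE scaler_sumr.
    rewrite (bigID (mem P)) /=.
    by congr (_ + _); apply: eq_bigr => q _; rewrite /G scalerA.
  rewrite big_split /= sum_antisym ?add0r // => i j.
  by rewrite /G -opprB vortex_kernelN scalerN mulrC.
apply: (@le_trans _ _
    (\sum_(p in P) \sum_(q | q \notin P) `|a p| * `|a q| * L `^ (- alpha))).
  apply: ler_enorm_sum => p pP; apply: ler_enorm_sum => q qP.
  rewrite /G enormZ normrM ler_wpM2l ?mulr_ge0 //.
  by rewrite enorm_vortex_kernel_le // Psep.
under eq_bigr do rewrite -mulr_suml -mulr_sumr.
rewrite -mulr_suml -mulr_suml ler_wpM2r ?powR_ge0 // expr2.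
by apply: ler_pM; rewrite ?sumr_ge0 // ler_sum_cond.
Qed.

(** * Splitting a finite metric space along a gap *)

(** The set [A] is the connected component of [p] in the graph linking the points
    at distance at most [rho]; a path without repetition in it has fewer than
    [#|T|] edges, so it cannot reach [q]. *)
Lemma exists_gap_split (R : realType) (T : finType) (d : T -> T -> R) (rho : R)
    (p q : T) :
  (forall x, d x x = 0) -> (forall x y z, d x z <= d x y + d y z) ->
  0 <= rho -> #|T|%:R * rho < d p q ->
  exists A : {set T}, [/\ p \in A, q \notin A &
    forall x y, x \in A -> y \notin A -> rho < d x y].
Proof.
move=> d0 dD rho0 pq; pose e x y := d x y <= rho.
exists [set x | connect e p x]%SET; split.
- by rewrite inE connect0.
- rewrite inE; apply/negP => /connectP[w wP qE].
  (* Removing the loops of the path bounds its length by the number of points. *)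
  move: pq; rewrite {}qE; case: (shortenP wP) => {w wP} w wP w_uniq _.
  rewrite ltNge => /negP; apply.
  apply: (@le_trans _ _ ((size w)%:R * rho)).
    elim: w p wP {w_uniq} => [|y w IHw] x /=; first by rewrite d0 mul0r.
    move=> /andP[xy /IHw yw]; apply: le_trans (dD x y _) _.
    by rewrite -natr1 mulrDl mul1r addrC lerD.
  rewrite ler_wpM2r // ler_nat; move/card_uniqP: w_uniq => /= wE.
  by rewrite ltnW // -wE max_card.
- move=> x y; rewrite !inE => px pyN; rewrite ltNge; apply: contraNN pyN => xy.
  exact: connect_trans px (connect1 xy).
Qed.

(** * Continuous induction *)

(** If the inequality failed somewhere, let [e] be the infimum of the times of
    failure.  The weak bound [L] holds before [e], hence at [e] by continuity; then
    the strict improvement to [L'] at [e] propagates to a neighborhood of [e],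
    which contradicts the choice of [e]. *)
Lemma barrier_right (R : realType) (I : finType) (K : pred I) (f : I -> R -> R)
    (a b L L' : R) : L < L' ->
  (forall k r, K k -> a <= r <= b -> {for r, continuous (f k)}) ->
  (forall k, K k -> L <= f k a) ->
  (forall r, a <= r <= b ->
    (forall k r', K k -> a <= r' <= r -> L <= f k r') ->
    forall k, K k -> L' <= f k r) ->
  forall k r, K k -> a <= r <= b -> L <= f k r.
Proof.
move=> LL' fC fa boot k r Kk rab; rewrite leNgt; apply/negP => fkr.
pose E := [set r | a <= r <= b /\ exists2 k, K k & f k r < L].
have Er : E r by split => //; exists k.
have Elb : lbound E a by move=> ? [/andP[]].
have Einf : has_inf E by split; [exists r | exists a].
have eE z : E z -> inf E <= z by move=> /(ge_inf (proj2 Einf)).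
have ae : a <= inf E by apply: lb_le_inf; [exists r|].
have eb : inf E <= b by apply: le_trans (eE _ Er) _; case/andP: rab.
set e := inf E in eE ae eb.
have below k' r' : K k' -> a <= r' < e -> L <= f k' r'.
  move=> Kk' /andP[ar' r'e]; rewrite leNgt; apply/negP => fr'.
  have /eE : E r'.
    by split; [rewrite ar' (le_trans (ltW r'e))|exists k'].
  by rewrite leNgt r'e.
have at_e k' : K k' -> L <= f k' e.
  move=> Kk'; have [<-|ane] := eqVneq a e; first exact: fa.
  have aLe : a < e by rewrite lt_neqAle ane.
  have fe : f k' z @[z --> e^'-] --> f k' e.
    by apply: cvg_at_left_filter; apply: fC; rewrite // ae.
  apply: (cvgr_to_ge fe).
  near=> z; apply: below => //; apply/andP; split; last by near: z; exact: nbhs_left_lt.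
  by near: z; exact: nbhs_left_ge.
have after_e k' : K k' -> L < f k' e.
  move=> Kk'; apply: lt_le_trans LL' _; apply: boot => //; first by rewrite ae.
  move=> k'' r' Kk'' /andP[ar']; rewrite le_eqVlt => /orP[/eqP->|r'e].
    exact: at_e.
  by apply: below; rewrite // ar'.
have near_e k' : \forall z \near e, K k' -> L < f k' z.
  have [Kk'|_] := boolP (K k'); last by near=> z.
  have fe : {for e, continuous (f k')} by apply: fC; rewrite ?ae.
  by apply: filterS (cvgr_gt _ fe _ (after_e _ Kk')).
have /nbhs_ballP[eps /= eps0 ball_eps] :=
  filter_forall (nbhs_filter e) near_e.
have [z Ez ze] := inf_adherent eps0 Einf.
have ez := eE _ Ez.
have [_ [k' Kk' ]] := Ez.
apply/negP; rewrite -leNgt ltW //; apply: ball_eps => //.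
by rewrite /ball /= ler0_norm ?subr_le0 // opprB ltrBlDl.
Unshelve. all: by end_near. Qed.

(** The two-sided form, from an intermediate time [t]: the intervals before [t] are
    treated by reversing time. *)
Lemma barrier (R : realType) (I : finType) (K : pred I) (f : I -> R -> R)
    (s t u L L' : R) : L < L' -> s <= t <= u ->
  (forall k r, K k -> s <= r <= u -> {for r, continuous (f k)}) ->
  (forall k, K k -> L <= f k t) ->
  (forall r1 r2, s <= r1 <= t -> t <= r2 <= u ->
    (forall k r, K k -> r1 <= r <= r2 -> L <= f k r) ->
    forall k r, K k -> r1 <= r <= r2 -> L' <= f k r) ->
  forall k r, K k -> s <= r <= u -> L <= f k r.
Proof.
move=> LL' /andP[st tu] fC ft boot k r Kk /andP[sr ru].
have [tr|rt] := leP t r.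
  apply: (@barrier_right R I K f t u L L') => //; last by rewrite tr.
  - by move=> k' r' Kk' /andP[tr' r'u]; apply: fC => //; rewrite (le_trans st).
  - move=> r' /andP[tr' r'u] fr' k' Kk'.
    by apply: (boot t r'); rewrite ?lexx ?st ?tr' ?r'u.
rewrite -[r]opprK.
apply: (@barrier_right R I K (fun k r => f k (- r)) (- t) (- s) L L') => //.
- move=> k' r' Kk' /andP[tr' r's].
  apply: (@continuous_comp _ _ _ (fun z : R => - z) (f k')); first exact: opp_continuous.
  by apply: fC => //; rewrite lerNr r's lerNl (le_trans _ tr') // lerN2.
- by move=> k' Kk'; rewrite opprK; exact: ft.
- move=> r' /andP[tr' r's] fr' k' Kk'.
  apply: (boot (- r') t); rewrite ?lexx ?tu //.
  + by rewrite lerNr r's lerNl.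
  + move=> k'' r'' Kk'' /andP[r''1 r''2]; rewrite -[r'']opprK; apply: fr' => //.
    by rewrite lerN2 r''2 lerNl.
  + by rewrite /= lerNl.
- by rewrite !lerN2 sr ltW.
Qed.

(** * Confinement of isolated clusters *)

Definition separated {R : realType} {N : nat} (x : 'I_N -> R -> R * R)
    (P Q : {set 'I_N}) (L s u : R) : Prop :=
  forall p q r, p \in P -> q \in Q -> s <= r <= u -> L <= enorm (x p r - x q r).

(** The length [L] is free, so that the constant [C] is invariant under the scaling
    [(t, x) -> (L `^ (alpha + 1) * t, L * x)] of the system.  The intervals avoid
    the initial time, at which the trajectories are only one-sidedly continuous. *)
Definition confined {R : realType} {N : nat} (alpha T C : R)
    (x : 'I_N -> R -> R * R) (P : {set 'I_N}) : Prop :=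
  forall s u L, 0 < s -> u < T -> 0 < L -> u - s <= L `^ (alpha + 1) ->
    separated x P (~: P) L s u ->
    forall p r r', p \in P -> s <= r <= u -> s <= r' <= u ->
      enorm (x p r - x p r') <= C * L.

Lemma separated_sub (R : realType) (N : nat) (x : 'I_N -> R -> R * R)
    (P Q : {set 'I_N}) (L s u s' u' : R) : s <= s' -> u' <= u ->
  separated x P Q L s u -> separated x P Q L s' u'.
Proof.
move=> ss' u'u PQ p q r pP qQ /andP[s'r ru']; apply: PQ => //.
by rewrite (le_trans ss') // (le_trans ru').
Qed.

Lemma separated_sym (R : realType) (N : nat) (x : 'I_N -> R -> R * R)
    (P Q : {set 'I_N}) (L s u : R) :
  separated x P Q L s u -> separated x Q P L s u.
Proof. by move=> PQ p q r pQ qP sru; rewrite enorm_distC PQ. Qed.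

(** A part of an isolated cluster is itself isolated as long as it stays away from
    the other part. *)
Lemma separated_part (R : realType) (N : nat) (x : 'I_N -> R -> R * R)
    (P1 P2 : {set 'I_N}) (L s u : R) :
  separated x P1 P2 L s u ->
  separated x (P1 :|: P2) (~: (P1 :|: P2)) L s u -> separated x P1 (~: P1) L s u.
Proof.
move=> P12 P12C p q r pP1; rewrite inE => qP1 sru.
have [qP2|qP2] := boolP (q \in P2); first exact: P12.
by apply: P12C => //; rewrite !inE ?pP1 // negb_or qP1.
Qed.

Section Dynamics.
Context {R : realType} {N : nat}.
Variables (alpha : R) (a : 'I_N -> R) (T : R) (X : 'I_N -> R * R).
Variable x : 'I_N -> R -> R * R.
Hypothesis alpha_ge0 : 0 <= alpha.
Hypothesis x_sol : well_defined_solution alpha a T X x.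

Lemma continuous_dist i j r : 0 < r < T ->
  {for r, continuous (fun t => enorm (x i t - x j t))}.
Proof.
case: x_sol => _ _ xD _ rT; apply: cvg_enorm.
have xC k : x k t @[t --> r] --> x k r.
  apply: differentiable_continuous; apply/derivable1_diffP.
  by case: (xD k r rT).
by apply: cvgB.
Qed.

(** The speed is of order [L `^ (- alpha)] during a time at most
    [L `^ (alpha + 1)]. *)
Lemma enorm_center_move_le (P : {set 'I_N}) s u L : 0 < s -> s <= u -> u < T ->
  0 < L -> u - s <= L `^ (alpha + 1) -> separated x P (~: P) L s u ->
  enorm (\sum_(p in P) a p *: x p u - \sum_(p in P) a p *: x p s)
    <= (\sum_i `|a i|) ^+ 2 * L.
Proof.
case: x_sol => _ _ xD _ s0 su uT L0 usL Psep.
have LL : L `^ (- alpha) * L `^ (alpha + 1) = L.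
  rewrite -powRD; last by rewrite (gt_eqF L0) implybT.
  by rewrite addKr powRr1 // ltW.
apply: le_trans (_ : (\sum_i `|a i|) ^+ 2 * L `^ (- alpha) * (u - s) <= _).
  apply: (@mean_value_enorm R (fun r => \sum_(p in P) a p *: x p r)
    (fun r => \sum_(p in P) a p *: vortex_velocity alpha a (x ^~ r) p)) => //.
  - move=> r /andP[sr ru].
    rewrite (_ : (fun r => _) = \sum_(p in P) (a p \*: x p)); last first.
      by apply/funext => t; rewrite fct_sumE.
    elim/big_ind2 : _ => [|f f' g g' ? ?|p pP].
    + exact: is_derive_cst.
    + exact: is_deriveD.
    + apply: is_deriveZ; apply: xD.
      by rewrite (lt_le_trans s0) // (le_lt_trans ru).
  - move=> r rsu; apply: enorm_center_velocity_le => // p q pP qP.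
    by apply: Psep => //; rewrite inE.
by rewrite -mulrA -[X in _ <= _ * X]LL !ler_wpM2l ?powR_ge0 ?sqr_ge0.
Qed.

(** Bootstrap: while the two parts are [L]-separated, confinement moves
    each vortex by at most [C * L], so a separation [(2 * C + 2) * L] at time [t]
    never drops below [2 * L]. *)
Lemma separated_persists (P1 P2 : {set 'I_N}) (C s t u L : R) :
  confined alpha T C x P1 -> confined alpha T C x P2 ->
  0 < s -> s <= t <= u -> u < T -> 0 < L -> 0 <= C -> u - s <= L `^ (alpha + 1) ->
  separated x (P1 :|: P2) (~: (P1 :|: P2)) L s u ->
  separated x P1 P2 ((2 * C + 2) * L) t t ->
  separated x P1 P2 L s u.
Proof.
move=> cP1 cP2 s0 /andP[st tu] uT L0 C0 usL sep12 sept.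
have CL0 : 0 <= C * L by rewrite mulr_ge0 // ltW.
suff H : forall (k : 'I_N * 'I_N) r, (k.1 \in P1) && (k.2 \in P2) -> s <= r <= u ->
    L <= enorm (x k.1 r - x k.2 r).
  by move=> p q r pP1 qP2; apply: (H (p, q)); rewrite /= pP1.
apply: (@barrier _ _ (fun k : 'I_N * 'I_N => (k.1 \in P1) && (k.2 \in P2))
  (fun k r => enorm (x k.1 r - x k.2 r)) s t u L (2 * L)).
- by lra.
- by rewrite st.
- move=> k r _ /andP[sr ru]; apply: continuous_dist.
  by rewrite (lt_le_trans s0) // (le_lt_trans ru).
- move=> [p q] /= /andP[pP1 qP2].
  by apply: le_trans (sept p q t pP1 qP2 _); [lra | rewrite lexx].
- move=> r1 r2 /andP[sr1 r1t] /andP[tr2 r2u] sep [p q] r /= /andP[pP1 qP2] r12.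
  have s12 : separated x P1 P2 L r1 r2.
    by move=> p' q' r' p'P1 q'P2; apply: (sep (p', q')); rewrite /= p'P1.
  have sep12' := separated_sub sr1 r2u sep12.
  have s1 := separated_part s12 sep12'.
  have s2 : separated x P2 (~: P2) L r1 r2.
    apply: (@separated_part _ _ _ _ P1); first exact: separated_sym.
    by rewrite finset.setUC.
  have tr : r1 <= t <= r2 by rewrite r1t.
  have r1_gt0 : 0 < r1 by rewrite (lt_le_trans s0).
  have r2T : r2 < T by rewrite (le_lt_trans r2u).
  have r12L : r2 - r1 <= L `^ (alpha + 1) by apply: le_trans usL; lra.
  have mp := cP1 _ _ _ r1_gt0 r2T L0 r12L s1 p t r pP1 tr r12.
  have mq := cP2 _ _ _ r1_gt0 r2T L0 r12L s2 q r t qP2 r12 tr.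
  have := sept p q t pP1 qP2; rewrite lexx => /(_ isT).
  have := ler_enorm_distD (x p r) (x p t) (x q t).
  have := ler_enorm_distD (x q r) (x p r) (x q t).
  by lra.
Qed.

Lemma gap_split_at (t rho : R) (p q : 'I_N) :
  0 <= rho -> N%:R * rho < enorm (x p t - x q t) ->
  exists A : {set 'I_N}, [/\ p \in A, q \notin A &
    forall i j, i \in A -> j \notin A -> rho < enorm (x i t - x j t)].
Proof.
move=> rho0 pq.
apply: (@exists_gap_split R 'I_N (fun i j => enorm (x i t - x j t))) => //.
- by move=> i; rewrite subrr enorm0.
- by move=> i j k; exact: ler_enorm_distD.
- by rewrite card_ord.
Qed.

(** The total intensity times [x p], minus the moment [B] of the cluster, is
    [\sum_(q in P) a q *: (x p - x q)], which is small with the diameter; and [B]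
    itself moves little. *)
Lemma confined_of_diam_le (P : {set 'I_N}) (s u L D : R) :
  \sum_(i in P) a i != 0 ->
  0 < s -> u < T -> 0 < L -> u - s <= L `^ (alpha + 1) ->
  separated x P (~: P) L s u ->
  (forall p q r, p \in P -> q \in P -> s <= r <= u ->
    enorm (x p r - x q r) <= D * L) ->
  forall p r r', p \in P -> s <= r <= u -> s <= r' <= u ->
    enorm (x p r - x p r') <= `|\sum_(i in P) a i|^-1 *
      ((\sum_i `|a i|) ^+ 2 + 2 * (\sum_i `|a i|) * D) * L.
Proof.
move=> aP s0 uT L0 usL Psep diamP p r r' pP.
wlog rr' : r r' / r' <= r.
  move=> H; have [/H //|/ltW rr' sru sr'u] := leP r' r.
  by rewrite enorm_distC; exact: H.
move=> rsu r'su; case/andP: (rsu) => sr ru; case/andP: (r'su) => sr' r'u.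
set A := \sum_i `|a i|; set B := fun t => \sum_(q in P) a q *: x q t.
have A0 : 0 <= A by rewrite sumr_ge0.
have BL : enorm (B r - B r') <= A ^+ 2 * L.
  apply: enorm_center_move_le => //.
  - exact: lt_le_trans sr'.
  - exact: le_lt_trans ru _.
  - by apply: le_trans usL; lra.
  - exact: separated_sub Psep.
have DL0 : 0 <= D * L by apply: le_trans (diamP _ _ _ pP pP rsu); exact: enorm_ge0.
have offset t : s <= t <= u ->
    enorm ((\sum_(i in P) a i) *: x p t - B t) <= A * (D * L).
  move=> tsu; rewrite scaler_suml -sumrB.
  apply: (@le_trans _ _ (\sum_(q in P) `|a q| * (D * L))).
    by apply: ler_enorm_sum => q qP; rewrite -scalerBr enormZ ler_wpM2l // diamP.
  by rewrite -mulr_suml ler_wpM2r // ler_sum_cond.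
rewrite -mulrA mulrC ler_pdivlMr ?normr_gt0 // mulrC -enormZ scalerBr.
have -> : (\sum_(i in P) a i) *: x p r - (\sum_(i in P) a i) *: x p r' =
    (((\sum_(i in P) a i) *: x p r - B r) + (B r - B r')) +
    - ((\sum_(i in P) a i) *: x p r' - B r').
  by rewrite subrKA opprB [RHS]addrA subrK.
apply: le_trans (ler_enormD _ _) _; rewrite enormN.
apply: le_trans (lerD (ler_enormD _ _) (lexx _)) _.
apply: le_trans (lerD (lerD (offset _ rsu) BL) (offset _ r'su)) _.
by lra.
Qed.
End Dynamics.

(** The first term of the constant serves when the cluster splits at some time and
    the second one when its diameter is always at most
    [N%:R * (2 * C + 2) * L]. *)
Lemma confinement_step (R : realType) (N : nat) (alpha : R) (a : 'I_N -> R)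
    (T : R) (X : 'I_N -> R * R) (x : 'I_N -> R -> R * R) (P : {set 'I_N}) (C : R) :
  0 <= alpha -> well_defined_solution alpha a T X x ->
  \sum_(i in P) a i != 0 -> 0 <= C ->
  (forall Q : {set 'I_N}, Q \proper P -> Q != finset.set0 ->
    confined alpha T C x Q) ->
  confined alpha T (C + `|\sum_(i in P) a i|^-1 * ((\sum_i `|a i|) ^+ 2 +
    2 * (\sum_i `|a i|) * (N%:R * (2 * C + 2)))) x P.
Proof.
move=> alpha0 x_sol aP C0 IH s u L s0 uT L0 usL Psep p r r' pP rsu r'su.
set A := \sum_i `|a i|; set D := N%:R * (2 * C + 2).
have A0 : 0 <= A by rewrite sumr_ge0.
have D0 : 0 <= D by rewrite mulr_ge0 //; lra.
have M0 : 0 <= `|\sum_(i in P) a i|^-1 * (A ^+ 2 + 2 * A * D).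
  by rewrite mulr_ge0 ?invr_ge0 // addr_ge0 ?sqr_ge0 // mulr_ge0 // mulr_ge0.
have [[t [i [j [tsu iP jP far]]]]|near_P] := pselect (exists t i j,
    [/\ s <= t <= u, i \in P, j \in P & D * L < enorm (x i t - x j t)]).
- have rho0 : 0 <= (2 * C + 2) * L by rewrite mulr_ge0 ?(ltW L0) //; lra.
  have [|Q [iQ jQ Qgap]] := @gap_split_at R N x t _ i j rho0.
    by rewrite mulrA.
  have cQ : confined alpha T C x (P :&: Q).
    apply: IH; last by apply/set0Pn; exists i; rewrite inE iP.
    rewrite properE subsetIl; apply/subsetPn; exists j => //.
    by rewrite inE negb_and jQ orbT.
  have cQ' : confined alpha T C x (P :\: Q).
    apply: IH; last by apply/set0Pn; exists j; rewrite inE jP jQ.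
    by rewrite properE subsetDl; apply/subsetPn; exists i; rewrite // inE iQ.
  have PE : (P :&: Q) :|: (P :\: Q) = P by exact: setID.
  have sep12 : separated x (P :&: Q) (P :\: Q) L s u.
    apply: (@separated_persists _ _ _ _ _ _ _ x_sol _ _ C s t u) => //; rewrite ?PE //.
        move=> p' q' z; rewrite !inE => /andP[p'P p'Q] /andP[q'Q q'P].
    rewrite -eq_le => /eqP <-. exact/ltW/Qgap.
  have CL : C * L <= (C + `|\sum_(i in P) a i|^-1 * (A ^+ 2 + 2 * A * D)) * L.
    by rewrite ler_wpM2r ?(ltW L0) // lerDl.
  apply: le_trans CL.
  have [pQ|pQ] := boolP (p \in Q).
    apply: (cQ s u) => //; last by rewrite inE pP.
    by apply: separated_part sep12 _; rewrite PE.
  apply: (cQ' s u) => //; last by rewrite inE pP pQ.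
  apply: separated_part (separated_sym sep12) _.
  by rewrite finset.setUC PE.
- apply: (@le_trans _ _ (`|\sum_(i in P) a i|^-1 * (A ^+ 2 + 2 * A * D) * L)).
    apply: (@confined_of_diam_le _ _ _ _ _ _ _ alpha0 x_sol P s u) => //.
    move=> i j t iP jP tsu; rewrite leNgt; apply/negP => far.
    by apply: near_P; exists t, i, j.
  by rewrite ler_wpM2r ?(ltW L0) // lerDr.
Qed.

(** The constant depends on [a], [alpha] and [N] only, and not on the solution;
    it is made independent of [P] by summing over all the clusters. *)
Lemma confinement (R : realType) (N : nat) (alpha : R) (a : 'I_N -> R) :
  0 <= alpha -> non_neutral_subclusters a ->
  exists2 C : R, 0 <= C & forall T X x, well_defined_solution alpha a T X x ->
    forall P : {set 'I_N}, P \proper [set: 'I_N]%SET -> P != finset.set0 ->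
      confined alpha T C x P.
Proof.
move=> alpha0 aP.
suff /(_ N)[C C0 CP] : forall k, exists2 C : R, 0 <= C & forall T X x,
    well_defined_solution alpha a T X x ->
    forall P : {set 'I_N}, P \proper [set: 'I_N]%SET -> P != finset.set0 ->
      (#|P| <= k)%N -> confined alpha T C x P.
  exists C => // T X x x_sol P Pp P0; apply: CP x_sol _ Pp P0 _.
  by rewrite -[leqRHS]card_ord max_card.
elim=> [|k [C C0 CP]].
  by exists 0 => // T X x _ P _; rewrite -cards_eq0 leqn0 => /negPf->.
pose K (P : {set 'I_N}) := `|\sum_(i in P) a i|^-1 * ((\sum_i `|a i|) ^+ 2 +
    2 * (\sum_i `|a i|) * (N%:R * (2 * C + 2))).
have K0 P : 0 <= K P.
  by rewrite /K mulr_ge0 ?invr_ge0 // addr_ge0 ?sqr_ge0 // !mulr_ge0 ?sumr_ge0 //; lra.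
exists (C + \sum_P K P); first by rewrite addr_ge0 // sumr_ge0.
move=> T X x x_sol P Pp P0 Pk s u L s0 uT L0 usL Psep p r r' pP rsu r'su.
apply: (@le_trans _ _ ((C + K P) * L)); last first.
  rewrite ler_wpM2r ?(ltW L0) // lerD2l.
  by rewrite (bigD1 P) //= lerDl sumr_ge0.
apply: (@confinement_step _ _ _ _ _ _ _ _ _ alpha0 x_sol _ C0 _ s u) => //.
  by apply: aP => //; move: Pp; rewrite properT.
move=> Q QP Q0; apply: CP x_sol _ _ Q0 _.
  exact: proper_trans QP Pp.
by rewrite -ltnS (leq_trans (proper_card QP)).
Qed.

(** * Distances before a collapse *)

Lemma not_collapse_of_separated (R : realType) (T t L : R) (g : R -> R) :
  t < T -> 0 < L -> (forall r, t <= r < T -> L <= g r) ->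
  limf_einf (fun r => (g r)%:E) T^'- <> 0%E.
Proof.
move=> tT L0 gL g0; have : (L%:E <= limf_einf (fun r => (g r)%:E) T^'-)%E.
  rewrite limf_einfE; apply: le_ereal_sup_tmp.
  exists (ereal_inf ((fun r => (g r)%:E) @` [set r | t <= r < T])).
    exists [set r | t <= r < T] => //; near=> r; apply/andP; split.
      by near: r; exact: nbhs_left_ge.
    by near: r; exact: nbhs_left_lt.
  by apply/ereal_infP => _ [r rT <-]; rewrite lee_fin gL.
by rewrite g0 lee_fin leNgt L0.
Unshelve. all: by end_near. Qed.

(** At a larger distance, the whole system would split at time [t] into two parts
    containing [i] and [j] respectively, which would stay away from each
    other on every interval [[t, r]] with [r < T]. *)
Lemma dist_le_before_collapse (R : realType) (N : nat) (alpha : R)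
    (a : 'I_N -> R) (T C : R) (X : 'I_N -> R * R) (x : 'I_N -> R -> R * R) (i j : 'I_N) :
  0 <= alpha -> well_defined_solution alpha a T X x -> 0 <= C ->
  (forall P : {set 'I_N}, P \proper [set: 'I_N]%SET -> P != finset.set0 ->
    confined alpha T C x P) ->
  limf_einf (fun t : R => (enorm (x i t - x j t))%:E) T^'- = 0%E ->
  forall t, 0 < t < T ->
    enorm (x i t - x j t) <= N%:R * (2 * C + 2) * (T - t) `^ (alpha + 1)^-1.
Proof.
move=> alpha0 x_sol C0 CP ij t /andP[t0 tT].
set L := (T - t) `^ _; have L0 : 0 < L by rewrite powR_gt0 // subr_gt0.
have LT : L `^ (alpha + 1) = T - t.
  rewrite /L -powRrM mulVf ?powRr1 ?subr_ge0 ?ltW //.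
  by rewrite gt_eqF // ltr_wpDl.
rewrite leNgt; apply/negP => far.
have rho0 : 0 <= (2 * C + 2) * L by rewrite mulr_ge0 ?(ltW L0) //; lra.
have [|P [iP jP gap]] := @gap_split_at _ _ x t _ i j rho0.
  by rewrite mulrA.
apply: (@not_collapse_of_separated _ T t L _ tT L0 _ ij) => r /andP[tr rT].
have cP : confined alpha T C x P.
  apply: CP; last by apply/set0Pn; exists i.
  by rewrite properE finset.subsetT; apply/subsetPn; exists j.
have cP' : confined alpha T C x (~: P).
  apply: CP; last by apply/set0Pn; exists j; rewrite inE.
  by rewrite properE finset.subsetT; apply/subsetPn; exists i; rewrite // inE iP.
apply: (@separated_persists _ _ _ _ _ _ _ x_sol P (~: P) C t t r L) => //.
- by rewrite lexx.
- by rewrite LT lerD2r ltW.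
- by move=> p q z; rewrite finset.setUCr !inE.
- move=> p q z pP; rewrite inE => qP.
  by rewrite -eq_le => /eqP <-; exact/ltW/gap.
- by rewrite inE.
- by rewrite tr lexx.
Qed.

Theorem theorem1p2 (R : realType) (alpha : R) (N : nat) (a : 'I_N -> R)
    (halpha : 0 <= alpha) (hN : (1 <= N)%N)
    (ha : forall i, a i != 0) (hP : non_neutral_subclusters a) :
  exists C : R,
    forall (T : R) (X : 'I_N -> R * R) (x : 'I_N -> R -> R * R),
      0 < T -> well_defined_solution alpha a T X x ->
      forall i j : 'I_N, i != j ->
        limf_einf (fun t : R => (enorm (x i t - x j t))%:E) T^'- = 0%E ->
        forall t : R, 0 <= t < T -> `|T - t| <= 1 ->
          enorm (x i t - x j t) <= C * `|T - t| `^ (alpha + 1)^-1.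
Proof.
have [C C0 CP] := confinement halpha hP.
exists (N%:R * (2 * C + 2)) => T X x T0 x_sol i j _ ij t /andP[t0 tT] _.
have bound := dist_le_before_collapse halpha x_sol C0 (CP _ _ _ x_sol) ij.
rewrite ger0_norm ?subr_ge0 ?(ltW tT) //.
have [t_gt0|t_le0] := ltP 0 t; first by apply: bound; rewrite t_gt0.
have -> : t = 0 by apply/eqP; rewrite eq_le t_le0.
rewrite subr0.
(* At the initial time the estimate follows from the one at positive times, since
   the trajectories are right-continuous at 0. *)
have xC k : x k r @[r --> 0^'+] --> x k 0.
  case: x_sol => _ xC _ _; have T2 : 0 < T / 2 by rewrite divr_gt0.
  have /(continuous_within_itvP _ T2)[] : {within `[0, T / 2], continuous (x k)}.
    apply: continuous_subspaceW (xC k) => r /=; rewrite !in_itv /= => /andP[-> rT].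
    by apply: le_lt_trans rT _; lra.
  by [].
have dC : enorm (x i r - x j r) @[r --> 0^'+] --> enorm (x i 0 - x j 0).
  by apply: cvg_enorm; apply: cvgB.
apply: (cvgr_to_le dC); near=> r.
have r0 : 0 < r by near: r; exact: nbhs_right_gt.
have rT : r < T by near: r; exact: nbhs_right_lt.
apply: le_trans (bound r _) _; first by rewrite r0.
rewrite ler_wpM2l ?mulr_ge0 //; first by lra.
rewrite ge0_ler_powR ?nnegrE ?invr_ge0 //; lra.
Unshelve. all: by end_near. Qed.
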